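(* No subset of $\mathbb{H}^2$ is both a focus/directrix parabola and a two-focus parabola. Moreover, no parabola in $\mathbb{H}^2$ of either kind is closed (i.e. compact).
   Context: $\mathbb{H}^2$ is the hyperbolic plane (constant curvature $-1$) with Riemannian distance $d$; lines are geodesics. Focus/directrix parabola: a set $\{x\in\mathbb{H}^2 : \sinh d(x,a_1)=\sinh d(x,\ell)\}$ (equivalently $d(x,a_1)=d(x,\ell)$), where $a_1\in\mathbb{H}^2$ (the focus) and $\ell$ is a line not passing through $a_1$ (the directrix). Two-focus parabola: the limiting case of a one-parameter family of two-focus ellipses $\{x : d(x,a_1)+d(x,a_2)=c_t\}$, where $c_t>d(a_1,a_2)$, $a_1$ is fixed, and $a_2$ runs off to infinity along the major axis (the line joining the foci) while $c_t-d(a_1,a_2)$ is kept fixed. Explicitly: for a unit-speed geodesic ray $\gamma:[0,\infty)\to\mathbb{H}^2$ with $\gamma(0)=a_1$ and a constant $k>0$, it is the set $\{x\in\mathbb{H}^2 : \lim_{t\to\infty}\bigl(d(x,a_1)+d(x,\gamma(t))-t\bigr)=k\}$. A curve in $\mathbb{H}^2$ is called closed if it is compact. *)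

(* Defs.v *)
From HB Require Import structures.
From mathcomp Require Import all_boot all_order all_algebra.
From mathcomp Require Import ring lra.
From mathcomp Require Import all_classical all_reals all_analysis.

Set Implicit Arguments.
Unset Strict Implicit.
Unset Printing Implicit Defensive.

Import Order.TTheory GRing.Theory Num.Theory.
Import numFieldNormedType.Exports.

Local Open Scope classical_set_scope.
Local Open Scope ring_scope.

Section hyperbolic_functions.
Context {R : realType}.

Definition sinhR (x : R) : R := (expR x - expR (- x)) / 2.

(* The inverse of cosh : [0, +oo[ -> [1, +oo[; only meaningful for 1 <= x. *)
Definition arcosh (x : R) : R := ln (x + Num.sqrt (x ^+ 2 - 1)).

Lemma arcosh1 : arcosh 1 = 0.
Proof. by rewrite /arcosh expr1n subrr sqrtr0 addr0 ln1. Qed.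

Lemma arcosh_eq0 (x : R) : 1 <= x -> arcosh x = 0 -> x = 1.
Proof.
move=> x1; have s0 := sqrtr_ge0 (x ^+ 2 - 1).
move/eqP; rewrite ln_eq0; last by lra.
by move=> /eqP xs; lra.
Qed.

Lemma arcosh_le_add (a b c : R) : 1 <= a -> 1 <= b -> 1 <= c ->
  (c - a * b) ^+ 2 <= (a ^+ 2 - 1) * (b ^+ 2 - 1) ->
  arcosh c <= arcosh a + arcosh b.
Proof.
move=> a1 b1 c1 abc.
have pos (x : R) : 1 <= x -> 0 <= x ^+ 2 - 1 by move=> x1; nra.
rewrite /arcosh -lnM ?posrE; last 2 first.
- by have := sqrtr_ge0 (a ^+ 2 - 1); lra.
- by have := sqrtr_ge0 (b ^+ 2 - 1); lra.
have sa0 := sqrtr_ge0 (a ^+ 2 - 1); have sa2 := sqr_sqrtr (pos _ a1).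
have sb0 := sqrtr_ge0 (b ^+ 2 - 1); have sb2 := sqr_sqrtr (pos _ b1).
have cs : c - a * b <= Num.sqrt (a ^+ 2 - 1) * Num.sqrt (b ^+ 2 - 1).
  rewrite -sqrtrM ?pos//; apply: le_trans (ler_norm _) _.
  by rewrite -sqrtr_sqr ler_wsqrtr.
set p := Num.sqrt (a ^+ 2 - 1) in sa0 sa2 cs *.
set q := Num.sqrt (b ^+ 2 - 1) in sb0 sb2 cs *.
have m1 : 0 <= a * q + b * p.
  by rewrite addr_ge0// mulr_ge0//; lra.
have sc : Num.sqrt (c ^+ 2 - 1) <= a * q + b * p.
  rewrite -(ger0_norm m1) -sqrtr_sqr ler_wsqrtr//.
  have -> : (a * q + b * p) ^+ 2 = (a * b + p * q) ^+ 2 - 1.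
    transitivity (a ^+ 2 * q ^+ 2 + b ^+ 2 * p ^+ 2 + 2 * (a * b) * (p * q)).
      by ring.
    rewrite [RHS](_ : _ =
      (a * b) ^+ 2 + p ^+ 2 * q ^+ 2 + 2 * (a * b) * (p * q) - 1); last by ring.
    by rewrite sa2 sb2; ring.
  rewrite lerB// ler_sqr ?nnegrE//; last 2 first.
  - by lra.
  - by rewrite addr_ge0 ?mulr_ge0//; lra.
  by lra.
rewrite ler_ln ?posrE.
- by rewrite mulrDl !mulrDr; lra.
- by have := sqrtr_ge0 (c ^+ 2 - 1); lra.
- by rewrite mulr_gt0//; lra.
Qed.

End hyperbolic_functions.

Definition lorentz {R : realType} (u v : R * R * R) : R :=
  u.1.1 * v.1.1 + u.1.2 * v.1.2 - u.2 * v.2.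

(* The hyperbolic plane of curvature -1 in the hyperboloid model: the upper
   sheet of <u, u> = -1 for the Lorentz form, with cosh d(u, v) = - <u, v>. *)
Record hyp_plane (R : realType) := HypPlane {
  hval :> R * R * R ;
  _ : (lorentz hval hval == - 1) && (0 < hval.2) }.

HB.instance Definition _ (R : realType) := [isSub for @hval R].
HB.instance Definition _ (R : realType) := [Choice of hyp_plane R by <:].

Section hyp_plane_metric.
Context {R : realType}.
Implicit Types u v w : hyp_plane R.

Definition hdist u v : R := arcosh (- lorentz u v).

Let hypP u : u.1.1 ^+ 2 + u.1.2 ^+ 2 + 1 = u.2 ^+ 2 /\ 0 < u.2.
Proof. by case: u => u /= /andP[/eqP]; rewrite /lorentz => h ->; split; lra. Qed.

Let lorentz_key u v : (- lorentz u v + u.1.1 * v.1.1 + u.1.2 * v.1.2) ^+ 2 =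
  (1 + u.1.1 * v.1.1 + u.1.2 * v.1.2) ^+ 2 + (u.1.1 - v.1.1) ^+ 2 +
  (u.1.2 - v.1.2) ^+ 2 + (u.1.1 * v.1.2 - u.1.2 * v.1.1) ^+ 2.
Proof.
have [hu _] := hypP u; have [hv _] := hypP v.
transitivity (u.2 ^+ 2 * v.2 ^+ 2); first by rewrite /lorentz; ring.
by rewrite -hu -hv; ring.
Qed.

Let lorentz_le u v : 1 <= - lorentz u v.
Proof.
have [_ u0] := hypP u; have [_ v0] := hypP v.
have key := lorentz_key u v.
have h0 : 0 < - lorentz u v + u.1.1 * v.1.1 + u.1.2 * v.1.2.
  rewrite [ltRHS](_ : _ = u.2 * v.2) ?mulr_gt0// /lorentz; ring.
have s1 := sqr_ge0 (u.1.1 - v.1.1); have s2 := sqr_ge0 (u.1.2 - v.1.2).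
have s3 := sqr_ge0 (u.1.1 * v.1.2 - u.1.2 * v.1.1).
rewrite leNgt; apply/negP => lt1.
have : (- lorentz u v + u.1.1 * v.1.1 + u.1.2 * v.1.2) ^+ 2 <
       (1 + u.1.1 * v.1.1 + u.1.2 * v.1.2) ^+ 2.
  by rewrite ltr_sqr ?nnegrE; lra.
by lra.
Qed.

Let lorentzC u v : lorentz u v = lorentz v u.
Proof. by rewrite /lorentz; ring. Qed.

Let hdistxx u : hdist u u = 0.
Proof.
have -> : hdist u u = arcosh (- - 1).
  by rewrite /hdist; case: u => u /= /andP[/eqP -> _].
by rewrite opprK arcosh1.
Qed.

Let hdist_positivity u v : hdist u v = 0 -> u = v.
Proof.
move=> /(arcosh_eq0 (lorentz_le u v)) uv1.
have [hu u0] := hypP u; have [hv v0] := hypP v.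
have := lorentz_key u v; rewrite uv1.
have s1 := sqr_ge0 (u.1.1 - v.1.1); have s2 := sqr_ge0 (u.1.2 - v.1.2).
have s3 := sqr_ge0 (u.1.1 * v.1.2 - u.1.2 * v.1.1) => key.
have /eqP : (u.1.1 - v.1.1) ^+ 2 = 0 by lra.
rewrite sqrf_eq0 subr_eq0 => /eqP e1.
have /eqP : (u.1.2 - v.1.2) ^+ 2 = 0 by lra.
rewrite sqrf_eq0 subr_eq0 => /eqP e2.
have /eqP e3 : u.2 == v.2.
  by rewrite -(@eqrXn2 _ 2%N) ?ltW// -hu -hv e1 e2.
apply: val_inj => /=.
by case: u v {u0 v0 hu hv s1 s2 s3 key uv1} e1 e2 e3
  => [[[? ?] ?] ?] [[[? ?] ?] ?] /= -> -> ->.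
Qed.

Let hdist_sym u v : hdist u v = hdist v u.
Proof. by rewrite /hdist lorentzC. Qed.

(* The Gram matrix of three points has determinant - det [u v w] ^+ 2. *)
Let hdist_triangle v u w : hdist u w <= hdist u v + hdist v w.
Proof.
apply: arcosh_le_add; [exact: lorentz_le..|].
have gram (x y z : R * R * R) :
  lorentz x x * (lorentz y y * lorentz z z - lorentz y z ^+ 2) -
  lorentz x y * (lorentz x y * lorentz z z - lorentz y z * lorentz x z) +
  lorentz x z * (lorentz x y * lorentz y z - lorentz y y * lorentz x z) =
  - (x.1.1 * (y.1.2 * z.2 - y.2 * z.1.2) - x.1.2 * (y.1.1 * z.2 - y.2 * z.1.1)
     + x.2 * (y.1.1 * z.1.2 - y.1.2 * z.1.1)) ^+ 2.
  by rewrite /lorentz; ring.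
have hypE (x : hyp_plane R) : lorentz x x = - 1 by case: x => x /= /andP[/eqP].
have := gram u v w; rewrite !hypE; move: (_ + u.2 * _) => D g.
have := sqr_ge0 D; nra.
Qed.

HB.instance Definition _ := isMetric.Build R (hyp_plane R)
  hdistxx hdist_positivity hdist_sym hdist_triangle.

End hyp_plane_metric.

Section parabolas.
Context {R : realType}.
Local Notation H2 := (hyp_plane R).

Definition geodesic_line (l : set H2) : Prop :=
  exists2 g : R -> H2,
    (forall s t, mdist (g s) (g t) = `|s - t|) & l = range g.

(* A ray is parametrized by [0, +oo[; values at negative times are irrelevant. *)
Definition geodesic_ray (g : R -> H2) : Prop :=
  forall s t, 0 <= s -> 0 <= t -> mdist (g s) (g t) = `|s - t|.

Definition dist_to (x : H2) (l : set H2) : R := inf [set mdist x y | y in l].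

Definition focus_directrix_parabola (P : set H2) : Prop :=
  exists (a1 : H2) (l : set H2), [/\ geodesic_line l, ~ l a1 &
    P = [set x | sinhR (mdist x a1) = sinhR (dist_to x l)]].

Definition two_focus_parabola (P : set H2) : Prop :=
  exists (a1 : H2) (g : R -> H2) (k : R),
    [/\ geodesic_ray g, g 0 = a1, 0 < k &
      P = [set x | mdist x a1 + mdist x (g t) - t @[t --> +oo] --> k]].

End parabolas.

(* Main.v *)
(* In the hyperboloid model with Lorentz form <., .>, let a future causal vector
   e be given. A focus/directrix parabola has two distinct ideal points, so
   - <x, e> is unbounded on it, for timelike e (the parabola is unbounded) as
   well as for null e (it lies in no horoball). On a two-focus parabola with
   focus a, the Busemann function ln (- <x, e>) of the ray, e null, equals
   k - d(x, a) <= k, so the parabola does lie in a horoball. It is nevertheless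
   unbounded, as it contains points with - <x, e> arbitrarily small. *)
Require Import Defs.
From HB Require Import structures.
From mathcomp Require Import all_boot all_order all_algebra.
From mathcomp Require Import ring lra.
From mathcomp Require Import all_classical all_reals all_analysis.

Set Implicit Arguments.
Unset Strict Implicit.
Unset Printing Implicit Defensive.

Import Order.TTheory GRing.Theory Num.Theory.
Import numFieldNormedType.Exports.

Local Open Scope classical_set_scope.
Local Open Scope ring_scope.

(** * Hyperbolic functions and [arcosh] *)

Section hyperbolic_functions.
Context {R : realType}.
Implicit Types s t y z K : R.

Definition coshR t : R := (expR t + expR (- t)) / 2.

Lemma expRMexpRN t : expR t * expR (- t) = 1.
Proof. by rewrite expRN divff// gt_eqF ?expR_gt0. Qed.

Lemma cosh2Bsinh2 t : coshR t ^+ 2 - sinhR t ^+ 2 = 1.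
Proof. by rewrite -(expRMexpRN t) /coshR /sinhR; field. Qed.

Lemma coshRB s t : coshR (s - t) = coshR s * coshR t - sinhR s * sinhR t.
Proof. by rewrite /coshR /sinhR opprB addrC !expRD; field. Qed.

Lemma coshRN t : coshR (- t) = coshR t.
Proof. by rewrite /coshR opprK addrC. Qed.

Lemma sinhR_gt0 t : 0 < t -> 0 < sinhR t.
Proof. by move=> t0; rewrite /sinhR divr_gt0// subr_gt0 ltr_expR; lra. Qed.

Lemma arcoshK y : 1 <= y -> coshR (arcosh y) = y.
Proof.
move=> y1; have s0 := sqrtr_ge0 (y ^+ 2 - 1).
have s2 : Num.sqrt (y ^+ 2 - 1) ^+ 2 = y ^+ 2 - 1 by rewrite sqr_sqrtr//; nra.
rewrite /coshR /arcosh expRN lnK ?posrE; last by lra.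
have : y + Num.sqrt (y ^+ 2 - 1) != 0 by rewrite gt_eqF//; lra.
move: (Num.sqrt _) s0 s2 => s s0 s2 ys0.
by field: s2.
Qed.

Lemma arcosh_mean K : 1 <= K -> arcosh ((K + K^-1) / 2) = ln K.
Proof.
move=> K1; rewrite /arcosh [X in Num.sqrt X](_ : _ = ((K - K^-1) / 2) ^+ 2).
  rewrite sqrtr_sqr ger0_norm; first by congr ln; lra.
  have : K^-1 <= 1 by rewrite invf_le1; lra.
  by lra.
by field; rewrite gt_eqF//; lra.
Qed.

Lemma ln_le_arcosh y : 1 <= y -> ln y <= arcosh y.
Proof.
move=> y1; have s0 := sqrtr_ge0 (y ^+ 2 - 1).
by rewrite /arcosh ler_ln ?posrE; lra.
Qed.

Lemma ler_arcosh y z : 1 <= y -> y <= z -> arcosh y <= arcosh z.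
Proof.
move=> y1 yz; have s0 := sqrtr_ge0 (y ^+ 2 - 1).
rewrite /arcosh ler_ln ?posrE; [|lra|by have := sqrtr_ge0 (z ^+ 2 - 1); lra].
by rewrite lerD// ler_wsqrtr// lerB// ler_sqr ?nnegrE; lra.
Qed.

End hyperbolic_functions.

(** * Linear algebra of the Lorentz form *)

Section lorentz.
Context {R : realType}.
Implicit Types (u v w x y : R * R * R) (a b c : R).

Definition lcomb a u b v c w : R * R * R :=
  (a * u.1.1 + b * v.1.1 + c * w.1.1, a * u.1.2 + b * v.1.2 + c * w.1.2,
   a * u.2 + b * v.2 + c * w.2).

(** The Euclidean cross product with its last coordinate negated, so that [lorentz (lcross u v) x]
    is the determinant of (u, v, x). *)
Definition lcross u v : R * R * R :=
  (u.1.2 * v.2 - u.2 * v.1.2, u.2 * v.1.1 - u.1.1 * v.2,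
   u.1.2 * v.1.1 - u.1.1 * v.1.2).

Lemma lorentzC u v : lorentz u v = lorentz v u.
Proof. by rewrite /lorentz; ring. Qed.

Lemma lorentz_comb a u b v c w x :
  lorentz (lcomb a u b v c w) x =
  a * lorentz u x + b * lorentz v x + c * lorentz w x.
Proof. by rewrite /lorentz/=; ring. Qed.

Lemma lorentz_crossl u v : lorentz u (lcross u v) = 0.
Proof. by rewrite /lorentz/=; ring. Qed.

Lemma lorentz_crossr u v : lorentz v (lcross u v) = 0.
Proof. by rewrite /lorentz/=; ring. Qed.

Lemma lorentz_cross u v : lorentz (lcross u v) (lcross u v) =
  lorentz u v ^+ 2 - lorentz u u * lorentz v v.
Proof. by rewrite /lorentz/=; ring. Qed.

(** [lcross u v] completes such a pair to a Lorentz orthonormal basis. *)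
Definition orthopair u v :=
  [/\ lorentz u u = - 1, lorentz v v = 1 & lorentz u v = 0].

(* The product of the determinants of (u, v, x) and (u, v, y) is minus the
   mixed Gram determinant. *)
Lemma lorentzE u v x y : orthopair u v ->
  lorentz x y = - (lorentz u x * lorentz u y) + lorentz v x * lorentz v y +
                lorentz (lcross u v) x * lorentz (lcross u v) y.
Proof.
move=> [uu vv uv].
have : lorentz (lcross u v) x * lorentz (lcross u v) y =
  - (lorentz u u * (lorentz v v * lorentz x y - lorentz v x * lorentz v y)
     - lorentz u v * (lorentz u v * lorentz x y - lorentz v x * lorentz u y)
     + lorentz u x * (lorentz u v * lorentz v y - lorentz v v * lorentz u y)).
  by rewrite /lorentz/=; ring.
by rewrite uu vv uv => ->; ring.
Qed.

(** By Cauchy-Schwarz, unless [u] is zero, the spatial part of [lorentz u v] is smaller in absolute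
    value than [u.2 * v.2], which therefore decides the sign. *)
Lemma lorentz_lt0 u v : lorentz u u <= 0 -> lorentz v v < 0 ->
  (lorentz u v < 0) = (0 < u.2 * v.2).
Proof.
rewrite /lorentz; case: u v => [[u1 u2] u3] [[v1 v2] v3] /= uu vv.
have sq (a b : R) := (sqr_ge0 a, sqr_ge0 b).
have [u30|u30] := eqVneq u3 0.
  have /eqP u10 : u1 == 0 by rewrite -sqrf_eq0; have := sq u1 u2; nra.
  have /eqP u20 : u2 == 0 by rewrite -sqrf_eq0; have := sq u1 u2; nra.
  by rewrite u10 u20 u30 !mul0r addr0 subr0.
have lt : (u1 * v1 + u2 * v2) ^+ 2 < (u3 * v3) ^+ 2.
  have U : 0 < u3 ^+ 2 by rewrite exprn_even_gt0.
  have := sqr_ge0 (u1 * v2 - u2 * v1); have := sq u1 u2; have := sq v1 v2.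
  by nra.
rewrite -[_ ^+ 2]real_normK ?num_real// in lt.
rewrite -[X in _ < X]real_normK ?num_real// in lt.
rewrite ltr_sqr ?nnegrE// in lt; move: lt; rewrite ltr_norml.
by case: (ltP 0 (u3 * v3)) => h; [rewrite gtr0_norm|rewrite ler0_norm];
  rewrite // => /andP[]; lra.
Qed.

End lorentz.

(** * Points, geodesics and lines on the hyperboloid *)

Section hyp_plane.
Context {R : realType}.
Local Notation H2 := (hyp_plane R).
Implicit Types (p q : H2) (l : set H2) (g : R -> H2).

Lemma hyp_lorentz p : lorentz p p = - 1.
Proof. by case: p => u /= /andP[/eqP]. Qed.

Lemma hyp_gt0 p : 0 < p.2.
Proof. by case: p => u /= /andP[]. Qed.

Lemma hyp_lorentz_lt0 (u : R * R * R) p : lorentz u u <= 0 ->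
  (lorentz u p < 0) = (0 < u.2).
Proof.
by move=> uu; rewrite lorentz_lt0 ?hyp_lorentz ?pmulr_lgt0 ?hyp_gt0//; lra.
Qed.

Lemma hyp_exists (u : R * R * R) p : lorentz u u = - 1 -> lorentz u p < 0 ->
  exists q, hval q = u.
Proof.
move=> uu up.
have hu : (lorentz u u == - 1) && (0 < u.2).
  by rewrite uu eqxx -(hyp_lorentz_lt0 p)//; lra.
by exists (HypPlane hu).
Qed.

Lemma mdistE p q : mdist p q = arcosh (- lorentz p q).
Proof. by []. Qed.

(* The square root of a negative number is 0, so [arcosh y = ln y < 0] when
   [0 < y < 1]. *)
Lemma lorentz_leN1 p q : 1 <= - lorentz p q.
Proof.
rewrite leNgt; apply/negP => lt1.
have : 0 <= mdist p q by exact: mdist_ge0.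
have : lorentz p q < 0 by rewrite hyp_lorentz_lt0 ?hyp_gt0 ?hyp_lorentz//; lra.
move: (lorentz p q) (mdistE p q) lt1 => y -> y1 y0.
rewrite /arcosh ler0_sqrtr; last by nra.
by rewrite addr0 leNgt ln_lt0//; lra.
Qed.

Lemma coshR_mdist p q : coshR (mdist p q) = - lorentz p q.
Proof. by rewrite mdistE arcoshK ?lorentz_leN1. Qed.

(** Here [v] is the unit tangent at [g 0]. Distances fix the components of [g t] along [g 0] and
    [v]; the third one vanishes since [g t] has Lorentz square -1. The domain [D] serves both lines
    and rays. *)
Lemma geodesic_orthopair (D : set R) g : D 0 -> D 1 ->
  (forall s t, D s -> D t -> mdist (g s) (g t) = `|s - t|) ->
  exists2 v, orthopair (g 0) v & forall t x, D t ->
    lorentz x (g t) = coshR t * lorentz x (g 0) + sinhR t * lorentz x v.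
Proof.
move=> D0 D1 gD.
have gE s t : D s -> D t -> lorentz (g s) (g t) = - coshR (s - t).
  move=> Ds Dt; apply/eqP; rewrite -eqr_oppLR -coshR_mdist gD//.
  by case: (ger0P (s - t)) => _; rewrite ?coshRN.
have s1 : 0 < sinhR (1 : R) by rewrite sinhR_gt0.
have cs1 := cosh2Bsinh2 (1 : R).
(* Solves g(1) = cosh(1) g(0) + sinh(1) v for v. *)
pose v := lcomb (sinhR 1)^-1 (g 1) (- coshR 1 / sinhR 1) (g 0) 0 (g 0).
have vg t : D t -> lorentz v (g t) = sinhR t.
  move=> Dt; rewrite lorentz_comb mul0r addr0 !gE// sub0r coshRN coshRB.
  by field; rewrite gt_eqF.
have gv : orthopair (g 0) v.
  split; first exact: hyp_lorentz.
    rewrite {1}/v lorentz_comb mul0r addr0 ![lorentz (g _) v]lorentzC !vg//.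
    by rewrite /sinhR oppr0 subrr mul0r mulr0 addr0 mulVf// gt_eqF.
  by rewrite lorentzC vg// /sinhR oppr0 subrr mul0r.
exists v => // t x Dt.
have gn0 : lorentz (lcross (g 0) v) (g t) = 0.
  have := lorentzE (g t) (g t) gv; rewrite hyp_lorentz vg// gE// sub0r coshRN.
  by have := cosh2Bsinh2 t; set y := lorentz _ _ => *; apply/eqP;
    rewrite -sqrf_eq0; apply/eqP; lra.
rewrite (lorentzE x (g t) gv) gn0 mulr0 addr0 vg// gE// sub0r coshRN.
by rewrite ![lorentz x _]lorentzC; ring.
Qed.

(** The plane orthogonal to [n] cuts the line out of the hyperboloid, and [lorentz n p] is the sinh
    of the signed distance from [p] to the line. *)
Lemma geodesic_line_normal l : geodesic_line l -> exists n,
  [/\ lorentz n n = 1,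
      forall p, dist_to p l = arcosh (Num.sqrt (1 + lorentz n p ^+ 2)) &
      forall p, lorentz n p = 0 -> l p].
Proof.
case=> g gg ->; have [//|//|s t _ _|v gv gE] := @geodesic_orthopair setT g.
  exact: gg.
pose n := lcross (g 0) v; pose c p : R := Num.sqrt (1 + lorentz n p ^+ 2).
have c1 p : 1 <= c p by rewrite -{1}sqrtr1 ler_wsqrtr// lerDl sqr_ge0.
have cE p : c p ^+ 2 = lorentz p (g 0) ^+ 2 - lorentz p v ^+ 2.
  rewrite sqr_sqrtr ?addr_ge0 ?sqr_ge0//.
  have := lorentzE p p gv; rewrite -/n hyp_lorentz ![lorentz p _]lorentzC.
  by move=> h; lra.
have cle p t : c p <= - lorentz p (g t).
  have := c1 p; have := lorentz_leN1 p (g t) => gt1 cp1.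
  rewrite -ler_sqr ?nnegrE; last 2 first.
  - by lra.
  - by lra.
  (* The difference of the two squares is the square of the derivative of [lorentz p (g t)] in
     [t]. *)
  rewrite cE (gE t)// -[leLHS]mulr1 -(cosh2Bsinh2 t).
  rewrite -subr_ge0 [leRHS](_ : _ =
    (sinhR t * lorentz p (g 0) + coshR t * lorentz p v) ^+ 2) ?sqr_ge0//.
  by ring.
have catt p : exists t, - lorentz p (g t) = c p.
  have := cE p; have := lorentz_leN1 p (g 0); have := c1 p.
  move: (c p) (lorentz p (g 0)) (lorentz p v) (gE ^~ p) => C A B {}gE C1 A1 CE.
  have AB : 0 < - A + B by nra.
  have AB' : 0 < - A - B by nra.
  have r0 : 0 < (- A + B) / C by rewrite divr_gt0//; lra.
  (* The derivative vanishes where tanh t = - B / A; as C^2 = A^2 - B^2, this means e^t = (B - A) /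
     C. *)
  exists (ln ((- A + B) / C)); rewrite gE// /coshR /sinhR expRN lnK ?posrE//.
  rewrite invf_div (_ : C / (- A + B) = (- A - B) / C); last first.
    apply/eqP; rewrite eqr_div ?lt0r_neq0//; last by lra.
    by apply/eqP; lra.
  by field: CE; rewrite gt_eqF//; lra.
exists n; split.
- by rewrite lorentz_cross; case: gv => -> -> ->; ring.
- move=> p; apply/eqP; rewrite eq_le; apply/andP; split.
  + have [t pt] := catt p; rewrite -/(c p) -pt -mdistE.
    apply: ge_inf; last by exists (g t) => //; exists t.
    by exists 0 => _ [y _ <-]; exact: mdist_ge0.
  + apply: lb_le_inf.
      by exists (mdist p (g 0)), (g 0) => //; exists 0.
    move=> _ [_ [t _ <-] <-]; rewrite mdistE.
    by apply: ler_arcosh; [exact: c1|exact: cle].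
- move=> p np; have [t pt] := catt p; exists t => //.
  apply: esym; apply: mdist_positivity; rewrite mdistE pt /c np.
  by rewrite expr0n addr0 sqrtr1 arcosh1.
Qed.

End hyp_plane.

Lemma compact_mdist_bounded (R : realType) (T : metricType R) (K : set T)
    (a : T) : compact K -> exists M, forall p, K p -> mdist p a <= M.
Proof.
move=> cK.
have dc : continuous (fun p : T => mdist p a).
  move=> p; apply/cvgrPdist_lt => e e0; near=> q.
  have pq : mdist p q < e.
    near: q; apply/nbhs_ballP; exists e => //= q.
    by rewrite ballEmdist.
  have := metric_triangle p q a; have := metric_triangle q p a.
  by rewrite (metric_sym q p) ltr_norml; lra.
have : compact ((fun p : T => mdist p a) @` K).
  by apply: continuous_compact => //; exact: continuous_subspaceT.
move=> /(@compact_bounded _ R^o) [M [_ bM]].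
exists (M + 1) => p Kp; apply: le_trans (ler_norm _) _.
by apply: (bM (M + 1)); [lra|exists p].
Unshelve. all: by end_near. Qed.

(** * Unboundedness of parabolas, and their position relative to horoballs *)

Section parabolas.
Context {R : realType}.
Local Notation H2 := (hyp_plane R).
Implicit Types (P : set H2) (a x : H2).

Lemma unbounded_not_compact P a :
  (forall M, exists2 x, P x & M <= - lorentz x a) -> ~ compact P.
Proof.
move=> unb /(compact_mdist_bounded a)[M bM].
have [x /bM xM Mx] := unb (expR (M + 1)).
have := le_trans (ln_le_arcosh (lorentz_leN1 x a)) xM.
rewrite leNgt => /negP; apply; apply: (@lt_le_trans _ _ (M + 1)); first lra.
rewrite -{1}(expRK (M + 1)) ler_ln ?posrE ?expR_gt0//.
by have := lorentz_leN1 x a; lra.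
Qed.

(* Let [m] be the foot of the perpendicular from the focus to the directrix and
   [w] the direction of the directrix at [m]. The points [A m + B w + C n] and
   [A m - B w + C n] of the parabola escape to two distinct ideal points, and
   no horoball contains both families. *)
Lemma focus_directrix_unbounded P (e : R * R * R) (M : R) :
  focus_directrix_parabola P -> lorentz e e <= 0 -> 0 < e.2 ->
  exists2 x, P x & M <= - lorentz x e.
Proof.
move=> [a [l [/geodesic_line_normal[n0 [n0n0 dn0 ln0]] la ->]]] ee e2.
have [n [nn dn na]] : exists n, [/\ lorentz n n = 1,
    forall p, dist_to p l = arcosh (Num.sqrt (1 + lorentz n p ^+ 2)) &
    0 < lorentz n a].
  case: (ltgtP (lorentz n0 a) 0) => [lt0|gt0|/ln0//]; last by exists n0.
  (* Flip the normal so that the focus lies on its positive side. *)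
  exists (lcomb (- 1) n0 0 n0 0 n0).
  have nE p : lorentz (lcomb (- 1) n0 0 n0 0 n0) p = - lorentz n0 p.
    by rewrite lorentz_comb; ring.
  split; [|by move=> p; rewrite nE sqrrN|by rewrite nE oppr_gt0].
  by rewrite nE lorentzC nE opprK.
clear n0 n0n0 dn0 ln0 la.
set S := lorentz n a in na; pose c := Num.sqrt (1 + S ^+ 2).
have c2 : c ^+ 2 = 1 + S ^+ 2 by rewrite sqr_sqrtr; nra.
have c0 : 0 < c by rewrite sqrtr_gt0; nra.
have cS : c < S + 1 by nra.
have cN0 : c != 0 by rewrite gt_eqF.
(* Project the focus orthogonally to [n] and normalize: a - S n has Lorentz square - c^2. *)
pose m := lcomb c^-1 a (- S / c) n 0 n.
have mE y : lorentz m y = (lorentz a y - S * lorentz n y) / c.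
  by rewrite lorentz_comb; field.
have mn : lorentz m n = 0 by rewrite mE nn [lorentz a n]lorentzC -/S; field.
have ma : lorentz m a = - c.
  by rewrite mE hyp_lorentz -/S; field: c2.
have mm : lorentz m m = - 1.
  by rewrite mE [lorentz a m]lorentzC ma [lorentz n m]lorentzC mn; field.
have omn : orthopair m n by split.
set w := lcross m n.
have mw : lorentz m w = 0 by exact: lorentz_crossl.
have nw : lorentz n w = 0 by exact: lorentz_crossr.
have ww : lorentz w w = 1 by rewrite lorentz_cross mm nn mn; ring.
have wa : lorentz w a = 0.
  have := mE w; rewrite mw nw mulr0 subr0 lorentzC => /esym/eqP.
  by rewrite mulf_eq0 invr_eq0 (negbTE cN0) orbF => /eqP.
have [q qm] : exists q : H2, hval q = m.
  by apply: (@hyp_exists _ _ a mm); rewrite ma; lra.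
have em : lorentz m e < 0 by rewrite -qm lorentzC hyp_lorentz_lt0.
(* In the basis m, n, w, causality of [e] bounds its spatial components by the time component. *)
have en : lorentz n e <= - lorentz m e.
  have := lorentzE e e omn; rewrite -/w => ee'.
  have := sqr_ge0 (lorentz w e); move: ee; rewrite ee'; nra.
pose kappa := (S + 1) / c - 1.
have k0 : 0 < kappa by rewrite subr_gt0 ltr_pdivlMr//; lra.
(* Once [B * lorentz w e <= 0], [en] gives - <x, e> >= (A - C) (- <m, e>), where A - C >= kappa C.
   The summand [c] keeps C large enough for [AD]. *)
pose C := c + `|M| / (kappa * - lorentz m e).
have Cc : c <= C by rewrite lerDl divr_ge0// mulr_ge0//; lra.
have CM : M <= C * (kappa * - lorentz m e).
  rewrite mulrDl divfK; last by rewrite gt_eqF// mulr_gt0//; lra.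
  have := ler_norm M; have : 0 <= c * (kappa * - lorentz m e); last by lra.
  by rewrite !mulr_ge0//; lra.
pose D := Num.sqrt (1 + C ^+ 2).
have D2 : D ^+ 2 = 1 + C ^+ 2 by rewrite sqr_sqrtr; nra.
have D0 : 0 < D by rewrite sqrtr_gt0; nra.
have CD : C <= D by nra.
(* [D] is the cosh of the distance to the directrix; this [A] makes the distance to the focus equal
   to it. *)
pose A := (C * S + D) / c.
have Ac : A * c = C * S + D by rewrite divfK.
have AC : C * (kappa + 1) <= A.
  by rewrite subrK mulrA ler_pM2r ?invr_gt0//; lra.
(* Makes A^2 - 1 - C^2 = A^2 - D^2 nonnegative, so that [B] exists. *)
have AD : D <= A.
  rewrite ler_pdivlMr// -lerBlDr.
  have -> : D * c - D = (c - 1) * D by ring.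
  rewrite -ler_sqr ?nnegrE; [|by nra|by nra].
  rewrite !exprMn D2.
  have -> : S ^+ 2 = (c - 1) * (c + 1) by lra.
  rewrite expr2 -mulrA [leRHS]mulrCA; apply: ler_wpM2l; nra.
(* The sign of [B] selects which of the two ideal points to approach. *)
have [B B2 Be] : exists2 B, B ^+ 2 = A ^+ 2 - 1 - C ^+ 2 & B * lorentz w e <= 0.
  have B0 : 0 <= A ^+ 2 - 1 - C ^+ 2 by nra.
  have sB := sqrtr_ge0 (A ^+ 2 - 1 - C ^+ 2).
  case: (lerP (lorentz w e) 0) => we.
    by exists (Num.sqrt (A ^+ 2 - 1 - C ^+ 2)); [rewrite sqr_sqrtr|nra].
  by exists (- Num.sqrt (A ^+ 2 - 1 - C ^+ 2)); [rewrite sqrrN sqr_sqrtr|nra].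
pose u := lcomb A m B w C n.
have um : lorentz m u = - A.
  rewrite lorentzC lorentz_comb mm [lorentz w m]lorentzC mw.
  by rewrite [lorentz n m]lorentzC mn; ring.
have uw : lorentz w u = B.
  by rewrite lorentzC lorentz_comb mw ww nw; ring.
have un : lorentz n u = C.
  by rewrite lorentzC lorentz_comb mn [lorentz w n]lorentzC nw nn; ring.
have uu : lorentz u u = - 1 by rewrite lorentz_comb um uw un; lra.
have ua : lorentz u a = - D by rewrite lorentz_comb ma wa -/S; lra.
have [x xu] : exists x : H2, hval x = u.
  by apply: (@hyp_exists _ _ a uu); rewrite ua; lra.
exists x => /=.
  by rewrite dn mdistE xu un ua opprK.
by rewrite xu lorentz_comb; nra.
Qed.

(* [y t] is cosh d(x, g t) for a ray [g]; the limit is the Busemann function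
   of [g] at [x]. *)
Lemma cvg_arcosh_horofunction (alpha beta : R) (y : R -> R) :
  (forall t, 0 <= t -> y t = - (coshR t * alpha + sinhR t * beta)) ->
  (forall t, 0 <= t -> 1 <= y t) -> 0 < - alpha - beta ->
  arcosh (y t) - t @[t --> +oo] --> ln (- alpha - beta).
Proof.
move=> yE y1 Z0.
(* Substitute r = e^(-t): then h(r) = r y(t) and arcosh(y(t)) - t = F(r), with [F] continuous at
   0. *)
pose h (r : R) : R := (- alpha - beta + (beta - alpha) * r ^+ 2) / 2.
pose F (r : R) : R := ln (h r + Num.sqrt (h r ^+ 2 - r ^+ 2)).
have F0 : F 0 = ln (- alpha - beta).
  rewrite /F /h expr0n mulr0 addr0 subr0 sqrtr_sqr ger0_norm; last by lra.
  by congr ln; field.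
have sqc : (r : R) ^+ 2 @[r --> (0 : R)] --> (0 : R) ^+ 2.
  exact: (@exprn_continuous R 2).
have hc : h r @[r --> (0 : R)] --> h 0.
  by apply: cvgMl; apply: cvgD; [exact: cvg_cst|apply: cvgMr].
have Fc : F r @[r --> (0 : R)] --> F 0.
  pose G (r : R) : R := h r + Num.sqrt (h r ^+ 2 - r ^+ 2).
  have Gc : G r @[r --> (0 : R)] --> G 0.
    apply: cvgD => //.
    apply: (@cvg_comp _ _ _ (fun r => h r ^+ 2 - r ^+ 2) (@Num.sqrt R) _
      (nbhs (h 0 ^+ 2 - 0 ^+ 2))); last exact: sqrt_continuous.
    apply: cvgB => //.
    exact: (@cvg_comp _ _ _ h (fun r => r ^+ 2) _ _ _ hc
      (@exprn_continuous R 2 _)).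
  have G0 : 0 < G 0.
    rewrite /G /h expr0n mulr0 addr0 subr0.
    by rewrite ltr_pwDl ?sqrtr_ge0//; lra.
  exact: (cvg_comp _ _ Gc (continuous_ln G0)).
rewrite -F0; have := cvg_comp _ _ (@cvgr_expR R) Fc.
apply: cvg_trans; apply: near_eq_cvg; near=> t => /=.
have t0 : 0 <= t by near: t; exact: nbhs_pinfty_ge.
have hE : h (expR (- t)) = expR (- t) * y t.
  have := expRMexpRN t; rewrite /h yE// /coshR /sinhR => et.
  by field: et.
have e0 := expR_gt0 (- t).
have s0 := sqrtr_ge0 (y t ^+ 2 - 1).
rewrite /F hE /arcosh exprMn -[X in _ - X]mulr1 -mulrBr.
rewrite sqrtrM ?sqr_ge0// sqrtr_sqr gtr0_norm//.
rewrite -mulrDr lnM ?posrE//; last by have := y1 t t0; lra.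
by rewrite expRK addrC.
Unshelve. all: by end_near. Qed.

Lemma two_focus_horofunction P : two_focus_parabola P ->
  exists (a : H2) (v : R * R * R) (k : R), [/\ 0 < k, orthopair a v &
    P = [set x | mdist x a + ln (- lorentz x a - lorentz x v) = k]].
Proof.
move=> [_ [g [k [gg <- k0 ->]]]].
have [//=|//=|s t s0 t0|v gv gE] := @geodesic_orthopair R [set t | 0 <= t] g.
  exact: gg.
exists (g 0), v, k; split => //.
have cvgE (x : H2) : mdist x (g 0) + mdist x (g t) - t @[t --> +oo] -->
    mdist x (g 0) + ln (- lorentz x (g 0) - lorentz x v).
  under eq_fun do rewrite -addrA.
  apply: cvgD; first exact: cvg_cst.
  apply: (cvg_arcosh_horofunction (y := fun t => - lorentz x (g t))).
  - by move=> t t0; rewrite gE.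
  - by move=> t _; exact: lorentz_leN1.
  (* Expanding <x, x> = -1 gives <x, g(0)>^2 >= 1 + <x, v>^2. *)
  - have := lorentz_leN1 x (g 0); have := lorentzE x x gv; rewrite hyp_lorentz.
    have := sqr_ge0 (lorentz (lcross (g 0) v) x).
    by rewrite [lorentz (g 0) x]lorentzC [lorentz v x]lorentzC; nra.
apply/seteqP; split => x /= xP.
  exact: (cvg_unique _ (cvgE x) xP).
by rewrite -xP; exact: cvgE.
Qed.

Lemma two_focus_bounded P : two_focus_parabola P -> exists e : R * R * R,
  [/\ lorentz e e <= 0, 0 < e.2 &
      exists M, forall x, P x -> - lorentz x e <= M].
Proof.
move=> /two_focus_horofunction[a [v [k [k0 [aa vv av] ->]]]].
(* The null vector a + v represents the ideal endpoint of the ray. *)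
pose e := lcomb 1 a 1 v 0 v.
have eE y : lorentz e y = lorentz a y + lorentz v y.
  by rewrite lorentz_comb; ring.
have ee : lorentz e e <= 0.
  rewrite eE ![lorentz _ e]lorentzC !eE aa vv av.
  by rewrite [lorentz v a]lorentzC av; lra.
exists e; split => //.
  by rewrite -(hyp_lorentz_lt0 a)// eE aa [lorentz v a]lorentzC av; lra.
exists (expR k) => x /= <-; rewrite lorentzC eE ![lorentz _ x]lorentzC opprD.
(* [expR (ln z)] bounds [z] even for z <= 0, where [ln] takes a default value. *)
apply: (@le_trans _ _ (expR (ln (- lorentz x a - lorentz x v)))).
  case: (lerP (- lorentz x a - lorentz x v) 0) => [le0|gt0].
    by apply: (le_trans le0); exact: expR_ge0.
  by rewrite lnK.
by rewrite ler_expR lerDr; exact: mdist_ge0.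
Qed.

Lemma two_focus_unbounded P : two_focus_parabola P ->
  exists a : H2, forall M, exists2 x, P x & M <= - lorentz x a.
Proof.
move=> /two_focus_horofunction[a [v [k [k0 oav ->]]]]; exists a => M.
have [aa vv av] := oav; set n := lcross a v.
have nn : lorentz n n = 1 by rewrite lorentz_cross aa vv av; ring.
have an : lorentz a n = 0 by exact: lorentz_crossl.
have vn : lorentz v n = 0 by exact: lorentz_crossr.
pose K := expR k; have K1 : 1 < K by rewrite -expR0 ltr_expR.
(* A point with horospheric coordinate [- lorentz x (a + v) = Z] lies on the
   parabola iff [- lorentz x a = (K / Z + Z / K) / 2]; let [Z] tend to 0. *)
pose Z := (1 + 2 * `|M|)^-1.
have M0 : 0 <= `|M| by [].
have Z0 : 0 < Z by rewrite invr_gt0; lra.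
have Z1 : Z <= 1 by rewrite invf_le1; lra.
pose X := (K / Z + (K / Z)^-1) / 2.
have XM : M <= X.
  have KZ : 1 + 2 * `|M| <= K / Z by rewrite invrK ler_peMl//; lra.
  have KZ0 : 0 < (K / Z)^-1 by rewrite invr_gt0; lra.
  by have := ler_norm M; rewrite /X; lra.
have X0 : 0 < X.
  by rewrite divr_gt0// addr_gt0 ?invr_gt0// divr_gt0//; lra.
(* Forced by <u, u> = -1: q^2 = 2 X Z - Z^2 - 1 with 2 X Z = K + Z^2 / K. *)
pose q := Num.sqrt ((K - 1) * (1 - Z ^+ 2 / K)).
have q2 : q ^+ 2 = (K - 1) * (1 - Z ^+ 2 / K).
  rewrite sqr_sqrtr// mulr_ge0//; first lra.
  by rewrite subr_ge0 ler_pdivrMr; nra.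
pose u := lcomb X a (X - Z) v q n.
have ua : lorentz u a = - X.
  rewrite lorentz_comb aa [lorentz v a]lorentzC av.
  by rewrite [lorentz n a]lorentzC an; ring.
have uv : lorentz u v = X - Z.
  by rewrite lorentz_comb vv av [lorentz n v]lorentzC vn; ring.
have un : lorentz u n = q by rewrite lorentz_comb an vn nn; ring.
have uu : lorentz u u = - 1.
  rewrite lorentz_comb ![lorentz _ u]lorentzC ua uv un -!expr2 q2.
  have -> : X = (K / Z + Z / K) / 2 by rewrite /X invf_div.
  by field; rewrite !gt_eqF//; lra.
have [x xu] : exists x : H2, hval x = u.
  by apply: (@hyp_exists _ _ a uu); rewrite ua; lra.
exists x; last by rewrite xu ua opprK.
rewrite /= mdistE xu ua uv opprK arcosh_mean; last first.
  by rewrite ler_pdivlMr//; lra.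
have -> : X - (X - Z) = Z by ring.
rewrite -lnM ?posrE ?divr_gt0//; last by lra.
by rewrite divfK ?gt_eqF// expRK.
Qed.

End parabolas.

Theorem theorem14 (R : realType) :
  (forall P : set (hyp_plane R),
     ~ (focus_directrix_parabola P /\ two_focus_parabola P)) /\
  (forall P : set (hyp_plane R),
     focus_directrix_parabola P \/ two_focus_parabola P -> ~ compact P).
Proof.
split=> P.
  move=> [fdP /two_focus_bounded[e [ee e0 [M bM]]]].
  have [x /bM xM] := focus_directrix_unbounded (M + 1) fdP ee e0.
  by rewrite leNgt => /negP; apply; lra.
move=> [fdP|/two_focus_unbounded[a]]; last exact: unbounded_not_compact.
have [a [l _]] := fdP; apply: (@unbounded_not_compact _ _ a) => M.
apply: (focus_directrix_unbounded M fdP); last exact: hyp_gt0.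
by rewrite hyp_lorentz; lra.
Qed.
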